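(* Every positive integer can be written as a sum of at most $15$ icosahedral numbers. Moreover, $15$ is the smallest positive integer with this property.
   Context: For a positive integer $n$, the $n$-th icosahedral number is $I_n=\frac{n(5n^2-5n+2)}{2}$. Repetitions are allowed in sums. *)

(* Defs.v *)
From mathcomp Require Import all_boot.

Set Implicit Arguments.
Unset Strict Implicit.
Unset Printing Implicit Defensive.

(* The truncated subtraction never truncates, since [5 * n <= 5 * n ^ 2] for
   every natural number [n], and the division by 2 is exact: see
   [icosahedral_double]. *)
Definition icosahedral (n : nat) : nat := (n * (5 * n ^ 2 - 5 * n + 2)) %/ 2.

Lemma icosahedral_double (n : nat) :
  2 * icosahedral n + 5 * n ^ 2 = 5 * n ^ 3 + 2 * n.
Proof.
rewrite /icosahedral mulnC divnK; last first.
  rewrite dvdn2 oddM oddD oddB ?leq_mul2l ?expnS ?expn0 ?muln1 ?oddM /=.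
    by case: (odd n).
  by case: n => // n; rewrite leq_pmull.
case: n => // n.
have le5 : 5 * n.+1 <= 5 * n.+1 ^ 2 by rewrite leq_mul2l expnS expn1 leq_pmull.
have -> : 5 * n.+1 ^ 2 = n.+1 * (5 * n.+1) by rewrite expnS expn1 mulnCA.
rewrite -mulnDr addnAC subnK; last by rewrite leq_pmull.
by rewrite mulnDr (mulnC _ 2) !expnS expn0 muln1 (mulnCA n.+1 5) (mulnCA n.+1 5).
Qed.

(* The list [s] holds the indices of the summands; repetitions are allowed. *)
Definition sum_of_at_most_icosahedral (k m : nat) : Prop :=
  exists s : seq nat,
    [/\ size s <= k, all (fun n => 0 < n) s & m = \sum_(n <- s) icosahedral n].

(* Main.v *)
Require Import Defs.
From mathcomp Require Import all_boot all_order all_algebra.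
From mathcomp Require Import zify ring.

(** Write [f] for [icosahedral]. The cubic terms cancel in
    [f (a + x) + f (a - x) = 2 * f a + 5 * (3 * a - 1) * x ^ 2]
    ([icosahedral_pair]), so that by Lagrange's theorem four such pairs
    represent every [8 * f a + 5 * (3 * a - 1) * q] with [q <= a ^ 2]
    ([sum_of_eight]). For large [n] it remains to bring [n - 8 * f a] into the
    class of 0 modulo [5 * (3 * a - 1)] at small cost. Take [P] an odd power of
    5, [3 * b = P + 1], [d] a prime congruent to 1 modulo 3, and
    [3 * a = d * P + 1], so that the modulus is [5 * P * d]. The factor [5 * P]
    is absorbed by a single [f c] with [c < 5 * P], because [f] permutes the
    residues modulo a power of 5 ([icosahedral_mod5X_onto]). The factor [d] is
    absorbed by two pairs around [b], which contribute
    [4 * f b + 5 * P * (x ^ 2 + y ^ 2)], because every residue modulo a prime is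
    a sum of two squares ([two_squares_mod_prime]). This uses 8 + 4 + 1 = 13
    summands, and it works for all [n] in a window of shape
    [(20 * d ^ 3 + O(1)) * P ^ 3 <= 27 * n <= 35 * d ^ 3 * P ^ 3]
    ([window_sum]). As 35 / 20 exceeds the cube of 6 / 5, the windows of
    successive primes overlap if their ratio is at most 6 / 5; twenty primes
    lead from one power [P] to the next one, [25 * P], and so cover all
    [n >= 3 * 10 ^ 16] ([large_sums]).

    Below this bound a greedy argument suffices: if [k] summands reach all of
    an interval at least as long as the gap between [f m] and [f (m + 1)], then
    [k + 1] summands reach from the same lower end to beyond [f (m + 1)]
    ([greedy_step]).
    The length of the interval grows roughly by the exponent 3 / 2 at each step,
    so six steps lead from [723, 2723], where a computation shows that 9
    summands suffice, beyond [3 * 10 ^ 16].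

    Finally 95 requires 15 summands: the only icosahedral numbers up to 95 are
    1, 12 and 48, and 95 = 48 + 3 * 12 + 11. *)

Set Implicit Arguments.
Unset Strict Implicit.
Unset Printing Implicit Defensive.

Import Order.TTheory GRing.Theory Num.Theory.

(** * Sums of four squares *)

Section IntegerSquares.
Local Open Scope ring_scope.

Definition four_squares (n : int) : Prop :=
  exists a b c d : int, n = a ^+ 2 + b ^+ 2 + c ^+ 2 + d ^+ 2.

(** Euler's identity: the norm of quaternions is multiplicative. *)
Lemma four_squaresM (m n : int) :
  four_squares m -> four_squares n -> four_squares (m * n).
Proof.
move=> [a [b [c [d ->]]]] [x [y [z [w ->]]]].
exists (a * x + b * y + c * z + d * w), (a * y - b * x + c * w - d * z).
exists (a * z - c * x + d * y - b * w), (a * w - d * x + b * z - c * y).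
by ring.
Qed.

Lemma symmetric_residue (m : nat) (x : int) : (0 < m)%N ->
  exists y z : int, x = y + m%:Z * z /\ - m%:Z < 2 * y <= m%:Z.
Proof.
move=> m_gt0; have := divz_eq x m; have := modz_ge0 x (d := m); have := ltz_pmod x (d := m).
set q := (x %/ m)%Z; set r := (x %% m)%Z => ltrm r_ge0 xE.
have [le_rm|lt_mr] := boolP (2 * r <= m%:Z); [exists r, q | exists (r - m%:Z), (q + 1)].
  split; first by rewrite {1}xE; ring.
  by lia.
split; first by rewrite {1}xE; ring.
by lia.
Qed.

(** The half-open range of the residues has only one value of maximal square,
    which is what settles the extreme case of the descent. *)
Lemma half_modulus_sqr (m : nat) (y : int) : - m%:Z < 2 * y <= m%:Z ->
  4 * y ^+ 2 <= m%:Z ^+ 2 /\ (4 * y ^+ 2 = m%:Z ^+ 2 -> 2 * y = m%:Z).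
Proof. by move=> ?; split; nia. Qed.

(** Fermat's descent. Reducing the four roots of [m * p] to residues
    [x, y, z, w] of absolute value at most [m / 2] gives
    [x ^ 2 + y ^ 2 + z ^ 2 + w ^ 2 = m * R] with [0 <= R <= m]. Both extremes
    would make [m] divide the prime [p]. Otherwise the coordinates of Euler's
    identity for [(m * R) * (m * p)] are all divisible by [m]; dividing by
    [m ^ 2] leaves [R * p]. *)
Lemma four_squares_descent (m p : nat) : (1 < m < p)%N -> prime p ->
  four_squares (m%:Z * p%:Z) ->
  exists2 r : nat, (0 < r < m)%N & four_squares (r%:Z * p%:Z).
Proof.
move=> /andP[m_gt1 ltmp] p_pr [a [b [c [d mpE]]]].
have m_gt0 : (0 < m)%N by apply: ltnW.
have Ndiv : ~ exists s : int, p%:Z = m%:Z * s.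
  move=> [s pE]; have /(prime_nt_dvdP p_pr) : (m %| p)%N
    by apply/dvdnP; exists `|s|%N; have := congr1 absz pE; rewrite abszM mulnC.
  by lia.
have [x [x' [aE xP]]] := symmetric_residue a m_gt0.
have [y [y' [bE yP]]] := symmetric_residue b m_gt0.
have [z [z' [cE zP]]] := symmetric_residue c m_gt0.
have [w [w' [dE wP]]] := symmetric_residue d m_gt0.
have [xle xeq] := half_modulus_sqr xP; have [yle yeq] := half_modulus_sqr yP.
have [zle zeq] := half_modulus_sqr zP; have [wle weq] := half_modulus_sqr wP.
(* This is [(x ^ 2 + y ^ 2 + z ^ 2 + w ^ 2) / m], solved from the equation of [m * p]. *)
pose R : int := p%:Z - 2 * (x * x' + y * y' + z * z' + w * w')
  - m%:Z * (x' ^+ 2 + y' ^+ 2 + z' ^+ 2 + w' ^+ 2).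
have RE : m%:Z * R = x ^+ 2 + y ^+ 2 + z ^+ 2 + w ^+ 2.
  by rewrite /R !mulrBr mpE aE bE cE dE; ring.
have m_gt0z : 0 < m%:Z by lia.
have R_ge0 : 0 <= R by rewrite -(pmulr_rge0 _ m_gt0z) RE !addr_ge0 // sqr_ge0.
have R_lem : R <= m%:Z.
  by rewrite -(ler_pM2l m_gt0z) RE -expr2; move: xle yle zle wle; clear; lia.
have R_neq0 : R != 0.
  apply/eqP => R0; rewrite R0 mulr0 in RE.
  have [x0 y0 z0 w0] : [/\ x = 0, y = 0, z = 0 & w = 0].
    have := sqr_ge0 x; have := sqr_ge0 y; have := sqr_ge0 z; have := sqr_ge0 w.
    by move: RE; clear; move=> *; split; apply/eqP; rewrite -sqrf_eq0; apply/eqP; lia.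
  apply: Ndiv; exists (x' ^+ 2 + y' ^+ 2 + z' ^+ 2 + w' ^+ 2).
  move: R0; rewrite /R x0 y0 z0 w0 !mul0r !addr0. move/eqP.
  by rewrite subr_eq0 => /eqP.
(* If [R = m], each residue is exactly [m / 2], so each root is an odd multiple of it. *)
have R_neqm : R != m%:Z.
  apply/eqP => Rm.
  have [xm ym zm wm] : [/\ 2 * x = m%:Z, 2 * y = m%:Z, 2 * z = m%:Z & 2 * w = m%:Z].
    rewrite Rm -expr2 in RE.
    by split; [apply: xeq | apply: yeq | apply: zeq | apply: weq];
      move: RE xle yle zle wle; clear; lia.
  apply: Ndiv; exists (1 + x' + y' + z' + w' + (x' ^+ 2 + y' ^+ 2 + z' ^+ 2 + w' ^+ 2)).
  have -> : p%:Z = R + (2 * x) * x' + (2 * y) * y' + (2 * z) * z' + (2 * w) * w'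
     + m%:Z * (x' ^+ 2 + y' ^+ 2 + z' ^+ 2 + w' ^+ 2) by rewrite /R; ring.
  by rewrite xm ym zm wm Rm; ring.
exists `|R|%N; first by move: R_ge0 R_lem R_neq0 R_neqm; clear; lia.
have -> : `|R|%N%:Z = R by move: R_ge0; clear; lia.
(* Euler's identity, with its first coordinate rewritten by means of [RE]. *)
exists (R + x * x' + y * y' + z * z' + w * w'),
 (y * x' - x * y' + w * z' - z * w'),
 (z * x' - x * z' + y * w' - w * y'), (w * x' - x * w' + z * y' - y * z').
have m_neq0 : m%:Z ^+ 2 != 0 by rewrite expf_neq0 // gt_eqF.
apply: (mulfI m_neq0).
transitivity ((m%:Z * R) * (m%:Z * p%:Z)); first by ring.
transitivity ((m%:Z * R + m%:Z * (x * x' + y * y' + z * z' + w * w')) ^+ 2 +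
  m%:Z ^+ 2 * ((y * x' - x * y' + w * z' - z * w') ^+ 2 +
 (z * x' - x * z' + y * w' - w * y') ^+ 2 +
 (w * x' - x * w' + z * y' - y * z') ^+ 2)); last by ring.
by rewrite RE mpE aE bE cE dE; ring.
Qed.

End IntegerSquares.

Lemma sqr_mod_prime_inj (p x y : nat) : prime p -> x <= p./2 -> y <= p./2 ->
  x ^ 2 = y ^ 2 %[mod p] -> x = y.
Proof.
move=> p_pr; wlog lexy : x y / x <= y => [IH xle yle eqxy|].
  by case: (leqP x y) => [|/ltnW] le; [|apply/esym]; apply: IH.
move=> xle yle /esym/eqP; rewrite eqn_mod_dvd ?leq_exp2r // subn_sqr Euclid_dvdM //.
have p_gt1 := prime_gt1 p_pr.
by case/orP => [dvd|dvd]; apply/eqP; rewrite eqn_leq lexy /=; have := dvdn_leq _ dvd; lia.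
Qed.

(** Pigeonhole: the [x ^ 2] and the [t - y ^ 2] with [x, y <= p / 2] are two
    families of pairwise distinct residues, with more than [p] members in
    total. The prime 2 needs no separate treatment, as 0 and 1 have distinct
    squares. *)
Lemma two_squares_mod_prime (p t : nat) : prime p ->
  exists x y : nat, [/\ x <= p./2, y <= p./2 & x ^ 2 + y ^ 2 = t %[mod p]].
Proof.
move=> p_pr; have p_gt0 := prime_gt0 p_pr.
(* [y ^ 2 * p.-1] stands for [- y ^ 2], which truncated subtraction cannot give. *)
pose F (s : 'I_(p./2).+1 + 'I_(p./2).+1) : 'I_p :=
  Ordinal (ltn_pmod (match s with inl x => x ^ 2 | inr y => t + y ^ 2 * p.-1 end) p_gt0).
have /injectivePn[u [v neq_uv /(congr1 val)/= eq_uv]] : ~~ injectiveb F.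
  by apply/negP => /injectiveP/leq_card; rewrite card_sum !card_ord; lia.
have addK (y : nat) : t + y ^ 2 * p.-1 + y ^ 2 = t %[mod p].
  by rewrite -addnA -mulnSr prednK // addnC modnMDl.
case: u v neq_uv eq_uv => [x|x] [y|y] neq_xy eq_xy.
- case/eqP: neq_xy; congr inl; apply/val_inj/(sqr_mod_prime_inj p_pr) => //; exact: leq_ord.
- exists x, y; split; [exact: leq_ord|exact: leq_ord|].
  by rewrite -modnDml eq_xy modnDml.
- exists y, x; split; [exact: leq_ord|exact: leq_ord|].
  by rewrite -modnDml -eq_xy modnDml.
- case/eqP: neq_xy; congr inr; apply/val_inj/(sqr_mod_prime_inj p_pr) => //; try exact: leq_ord.
  have Dx : t + x ^ 2 * p.-1 + (x ^ 2 + y ^ 2) = y ^ 2 + t %[mod p].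
    by rewrite addnA -modnDml addK modnDml addnC.
  have Dy : t + y ^ 2 * p.-1 + (x ^ 2 + y ^ 2) = x ^ 2 + t %[mod p].
    by rewrite [x ^ 2 + _]addnC addnA -modnDml addK modnDml addnC.
  have := congr1 (fun u => (u + (x ^ 2 + y ^ 2)) %% p) eq_xy.
  by rewrite !modnDml Dx Dy => /esym/eqP; rewrite eqn_modDr => /eqP.
Qed.

(** Solving [x ^ 2 + y ^ 2 + 1 = 0] modulo [p] within [p / 2] gives a multiple
    [m * p] with [m < p], from which the descent leads to [m = 1]. *)
Lemma prime_four_squares (p : nat) : prime p -> four_squares p.
Proof.
move=> p_pr; have p_gt1 := prime_gt1 p_pr.
have [x [y [xle yle sqE]]] := two_squares_mod_prime p.-1 p_pr.
have /dvdnP[m mE] : p %| x ^ 2 + y ^ 2 + 1.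
  by rewrite /dvdn -modnDml sqE modnDml addn1 prednK ?modnn // ltnW.
have m_gt0 : 0 < m by case: m mE => //; rewrite addn1.
have ltmp : m < p by rewrite -(ltn_pmul2r (ltnW p_gt1)) -mE; nia.
have : four_squares (m%:Z * p%:Z)%R.
  by exists (Posz x), (Posz y), 1%R, 0%R; rewrite -PoszM -mE; lia.
elim/ltn_ind: m m_gt0 ltmp {mE} => m IH m_gt0 ltmp.
have [->|m_neq1] := eqVneq m 1; first by rewrite mul1r.
have m_gt1 : 1 < m by rewrite ltn_neqAle eq_sym m_neq1.
case/(four_squares_descent _ p_pr); first by rewrite m_gt1.
move=> r /andP[r_gt0 ltrm]; apply: IH => //.
exact: ltn_trans ltmp.
Qed.

Lemma Lagrange_four_squares (n : nat) :
  exists a b c d : nat, n = a ^ 2 + b ^ 2 + c ^ 2 + d ^ 2.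
Proof.
suff [a [b [c [d nE]]]] : four_squares n.
  have absK (x : int) : Posz (`|x| ^ 2) = (x ^+ 2)%R.
    by rewrite -abszX gez0_abs ?sqr_ge0.
  by exists `|a|, `|b|, `|c|, `|d|; apply/eqP; rewrite -eqz_nat !PoszD !absK nE.
elim/ltn_ind: n => -[|n] IH; first by exists 0%R, 0%R, 0%R, 0%R.
have [->|n_neq0] := eqVneq n 0; first by exists 1%R, 0%R, 0%R, 0%R.
have n_gt1 : 1 < n.+1 by rewrite ltnS lt0n.
have p_pr := pdiv_prime n_gt1.
rewrite -(divnK (pdiv_dvd n.+1)) PoszM; apply: four_squaresM.
  by apply: IH; rewrite ltn_Pdiv ?prime_gt1.
exact: prime_four_squares.
Qed.

(** * Sums of icosahedral numbers *)

(** Here the index 0, whose icosahedral number is 0, is admitted as well: the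
    pair [a + x], [a - x] reaches it when [x = a]. *)
Definition icosahedral_sum (k m : nat) : Prop :=
  exists2 s : seq nat, size s <= k & m = \sum_(n <- s) icosahedral n.

Lemma icosahedral_sum_positive (k m : nat) :
  icosahedral_sum k m -> sum_of_at_most_icosahedral k m.
Proof.
case=> s le_sk ->; exists [seq n <- s | 0 < n]; split.
- by rewrite (leq_trans _ le_sk) // size_filter count_size.
- exact: filter_all.
by rewrite big_filter [RHS]big_mkcond; apply: eq_bigr => -[|n].
Qed.

Lemma icosahedral_sumD (k l m n : nat) :
  icosahedral_sum k m -> icosahedral_sum l n -> icosahedral_sum (k + l) (m + n).
Proof.
case=> s le_sk -> [t le_tl ->]; exists (s ++ t); last by rewrite big_cat.
by rewrite size_cat leq_add.
Qed.

Lemma icosahedral_sum1 (n : nat) : icosahedral_sum 1 (icosahedral n).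
Proof. by exists [:: n]; rewrite ?big_seq1. Qed.

Lemma icosahedral_sumW (k l m : nat) :
  k <= l -> icosahedral_sum k m -> icosahedral_sum l m.
Proof. by move=> le_kl [s le_sk ->]; exists s => //; apply: leq_trans le_kl. Qed.

Lemma icosahedral_pair (a x : nat) : 0 < a -> x <= a ->
  icosahedral (a + x) + icosahedral (a - x) =
  2 * icosahedral a + 5 * (3 * a).-1 * x ^ 2.
Proof.
move=> a_gt0 le_xa; have aE : a = a - x + x by rewrite subnK.
move: a_gt0 aE {le_xa}; move: (a - x) => y + aE; subst a => a_gt0.
have := icosahedral_double (y + x + x); have := icosahedral_double y.
have := icosahedral_double (y + x).
move: (icosahedral _) (icosahedral _) (icosahedral _) => u v w.
have : 5 * (3 * (y + x)).-1 * x ^ 2 + 5 * x ^ 2 = 15 * (y + x) * x ^ 2.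
  by rewrite -mulnDl; congr (_ * _); lia.
by lia.
Qed.

(** The coefficient of [x ^ 2] is what makes icosahedral numbers behave like
    squares in an arithmetic progression of modulus [5 * (3 * a - 1)]. *)
Lemma icosahedral_sum_pair (a x : nat) : 0 < a -> x <= a ->
  icosahedral_sum 2 (2 * icosahedral a + 5 * (3 * a).-1 * x ^ 2).
Proof.
move=> a_gt0 le_xa; rewrite -icosahedral_pair //.
by apply: (@icosahedral_sumD 1 1); apply: icosahedral_sum1.
Qed.

(** * Integers below the asymptotic range *)

Lemma icosahedralS (n : nat) :
  2 * icosahedral n.+1 = 2 * icosahedral n + 15 * n ^ 2 + 5 * n + 2.
Proof. by have := icosahedral_double n; have := icosahedral_double n.+1; nia. Qed.

(** Subtract the largest [icosahedral j] that leaves at least [A]. The gaps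
    between icosahedral numbers increase, so the hypothesis, which says that
    the gap after [m] is at most [W], bounds all earlier gaps, and the
    remainder lies in [[A, A + W]]. *)
Lemma greedy_step (A W k m : nat) :
  (forall n, A <= n <= A + W -> icosahedral_sum k n) ->
  15 * m ^ 2 + 5 * m + 2 <= 2 * W ->
  forall n, A <= n <= A + icosahedral m.+1 -> icosahedral_sum k.+1 n.
Proof.
move=> sumW; elim: m => [|m IH] gap n /andP[leAn len].
  apply: icosahedral_sumW (leqnSn k) _; apply: sumW.
  by move: len gap; rewrite (_ : icosahedral 1 = 1) //; lia.
have [len'|ltn] := leqP n (A + icosahedral m.+1).
  by apply: IH; [nia | rewrite leAn].
rewrite -(@subnK (icosahedral m.+1) n); last by lia.
rewrite -addn1; apply: icosahedral_sumD (icosahedral_sum1 _).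
apply: sumW; have := icosahedralS m.+1; lia.
Qed.

(** A mask is the characteristic sequence of a set of integers, so prepending
    [v] values [false] translates the set by [v]. Since [zip] truncates to the
    shorter sequence, all masks keep the length of the initial one. *)
Definition sums_mask_step (L : nat) (mask : bitseq) : bitseq :=
  foldr (fun v acc => [seq b.1 || b.2 | b <- zip acc (ncons v false mask)]) mask
   [seq icosahedral n | n <- iota 1 L].

Lemma sums_mask_stepP (L k : nat) (mask : bitseq) :
  (forall n, nth false mask n -> icosahedral_sum k n) ->
  forall n, nth false (sums_mask_step L mask) n -> icosahedral_sum k.+1 n.
Proof.
move=> maskP; rewrite /sums_mask_step; elim: (iota 1 L) => [|m s IH] n /=.
  by move/maskP; apply: icosahedral_sumW.
set acc := foldr _ _ _ in IH *; set sh := ncons _ _ _.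
have [lt_n|le_n] := ltnP n (size (zip acc sh)); last first.
  by rewrite nth_default // size_map.
rewrite (nth_map (false, false)) // nth_zip_cond lt_n /= => /orP[/IH //|].
rewrite nth_ncons; case: ltnP => // le_mn /maskP sum_n.
by rewrite -(subnK le_mn) -addn1; apply: icosahedral_sumD (icosahedral_sum1 _).
Qed.

Definition sums_mask (L B k : nat) : bitseq :=
  iter k (sums_mask_step L) (true :: nseq B false).

Lemma sums_maskP (L B k n : nat) :
  nth false (sums_mask L B k) n -> icosahedral_sum k n.
Proof.
elim: k n => [|k IH] n; last by apply: sums_mask_stepP.
by case: n => [_|n]; [exists [::]; rewrite ?big_nil | rewrite /= nth_nseq if_same].
Qed.

Lemma small_sums (n : nat) : n <= 723 -> icosahedral_sum 15 n.
Proof.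
move=> le_n; apply: (@sums_maskP 8 723).
have /all_nthP H : all id (sums_mask 8 723 15) by vm_compute.
apply: H; have -> : size (sums_mask 8 723 15) = 724 by vm_compute.
by [].
Qed.

(** 723 is the least possible lower end, since 722 is not a sum of 9 icosahedral
    numbers; indices up to 10 suffice, since [icosahedral 11] exceeds 2723. *)
Lemma medium_sums (n : nat) : 723 <= n <= 723 + 2000 -> icosahedral_sum 9 n.
Proof.
move=> /andP[le_n n_le]; apply: (@sums_maskP 10 2723).
have /all_nthP H : all id (drop 723 (sums_mask 10 2723 9)) by vm_compute.
have := H false (n - 723); rewrite nth_drop subnKC //; apply.
have -> : size (drop 723 (sums_mask 10 2723 9)) = 2001 by vm_compute.
by lia.
Qed.

Lemma sums_below_threshold (n : nat) : n <= 3 * 10 ^ 16 -> icosahedral_sum 15 n.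
Proof.
move=> le_n; have [/small_sums //|/ltnW ge_n] := leqP n 723.
(* The [m] of each step is taken, up to rounding, as large as the length
   of the interval already reached allows. *)
have sum10 := greedy_step (m := 16) medium_sums isT.
have sum11 := greedy_step (m := 39) sum10 isT.
have sum12 : forall n, 723 <= n <= 723 + icosahedral 145 -> icosahedral_sum 12 n.
  apply: greedy_step sum11 _; have := icosahedral_double 40; lia.
have sum13 : forall n, 723 <= n <= 723 + icosahedral (10 ^ 3).+1 -> icosahedral_sum 13 n.
  apply: greedy_step sum12 _; have := icosahedral_double 145; lia.
have sum14 : forall n, 723 <= n <= 723 + icosahedral (18 * 10 ^ 3).+1 -> icosahedral_sum 14 n.
  apply: greedy_step sum13 _; have := icosahedral_double (10 ^ 3).+1; lia.
apply: (greedy_step (m := 25 * 10 ^ 4) sum14).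
  have := icosahedral_double (18 * 10 ^ 3).+1; lia.
have := icosahedral_double (25 * 10 ^ 4).+1; lia.
Qed.

(** * Residues modulo powers of 5 *)

Lemma icosahedral_diff (x z : nat) : exists u,
  2 * icosahedral (x + z) = 2 * icosahedral x + z * (5 * u + 2).
Proof.
have [v vE] : exists v, x ^ 2 + x * (x + z) + (x + z) ^ 2 = v + x + (x + z).
  by exists (x ^ 2 + x * (x + z) + (x + z) ^ 2 - x - (x + z)); nia.
exists v; have := icosahedral_double (x + z); have := icosahedral_double x.
have : z * (x ^ 2 + x * (x + z) + (x + z) ^ 2) = z * (v + x + (x + z)) by rewrite vE.
by lia.
Qed.

(** The factor [5 * u + 2] of [icosahedral_diff] is prime to 5, so [5 ^ k]
    divides the difference of two values only if it divides that of the
    arguments. *)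
Lemma icosahedral_mod5X_inj (k x y : nat) : x < 5 ^ k -> y < 5 ^ k ->
  icosahedral x = icosahedral y %[mod 5 ^ k] -> x = y.
Proof.
wlog le_xy: x y / x <= y => [IH xk yk eqxy|xk yk].
  by case: (leqP x y) => [|/ltnW] le; [|apply/esym]; apply: IH.
have [z yE] : exists z, y = x + z by exists (y - x); rewrite subnKC.
rewrite {}yE in le_xy yk * => /esym/eqP.
have [u uE] := icosahedral_diff x z.
rewrite eqn_mod_dvd; last by lia.
have -> : (5 ^ k %| icosahedral (x + z) - icosahedral x) = (5 ^ k %| z).
  have cop2 : coprime (5 ^ k) 2 by rewrite coprimeXl.
  have cop5 : coprime (5 ^ k) (5 * u + 2).
    by rewrite coprimeXl // coprime_sym /coprime gcdnC mulnC gcdnMDl.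
  rewrite -(Gauss_dvdr _ cop2) mulnBr uE addKn.
  by rewrite Gauss_dvdl.
by case: z yk {le_xy uE} => [|z] yk; rewrite ?addn0 // gtnNdvd //; lia.
Qed.

Lemma icosahedral_mod5X_onto (k r : nat) :
  exists2 c, c < 5 ^ k & icosahedral c = r %[mod 5 ^ k].
Proof.
have q_gt0 : 0 < 5 ^ k by rewrite expn_gt0.
pose h (u : nat) : 'I_(5 ^ k) := Ordinal (ltn_pmod u q_gt0).
have h_inj : injective (fun c : 'I_(5 ^ k) => h (icosahedral c)).
  move=> x y /(congr1 val)/= /icosahedral_mod5X_inj eqxy.
  by apply/val_inj/eqxy.
have /codomP[c /(congr1 val)/= cE] := injF_onto h_inj (h r).
by exists c.
Qed.

(** * Integers in the asymptotic range *)

Lemma icosahedral_le (n : nat) : 2 * icosahedral n <= 5 * n ^ 3.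
Proof. by have := icosahedral_double n; nia. Qed.

Lemma split_by_prime (d t : nat) : prime d -> d ^ 2 <= 2 * t ->
  exists x y q, [/\ x <= d./2, y <= d./2 & t = x ^ 2 + y ^ 2 + d * q].
Proof.
move=> d_pr le_t; have [x [y [xle yle /esym/eqP]]] := two_squares_mod_prime t d_pr.
have : x ^ 2 + y ^ 2 <= t by have := odd_double_half d; nia.
move=> le_xyt; rewrite eqn_mod_dvd // => /dvdnP[q qE].
by exists x, y, q; split=> //; rewrite mulnC -qE subnKC.
Qed.

Lemma sum_of_eight (a d P q : nat) : 0 < a -> 3 * a = (d * P).+1 -> q <= a ^ 2 ->
  icosahedral_sum 8 (8 * icosahedral a + 5 * (d * P) * q).
Proof.
move=> a_gt0 aE le_q; have [x [y [z [w qE]]]] := Lagrange_four_squares q.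
have le_a u : u ^ 2 <= q -> u <= a.
  by move=> le_u; rewrite -leq_sqr; apply: leq_trans le_q.
have pair u : u ^ 2 <= q -> icosahedral_sum 2 (2 * icosahedral a + 5 * (d * P) * u ^ 2).
  by move/le_a => le_u; have := icosahedral_sum_pair a_gt0 le_u; rewrite aE.
have := icosahedral_sumD (icosahedral_sumD (pair x _) (pair y _))
         (icosahedral_sumD (pair z _) (pair w _)).
have -> : 8 * icosahedral a + 5 * (d * P) * q =
 2 * icosahedral a + 5 * (d * P) * x ^ 2 + (2 * icosahedral a + 5 * (d * P) * y ^ 2) +
 (2 * icosahedral a + 5 * (d * P) * z ^ 2 + (2 * icosahedral a + 5 * (d * P) * w ^ 2)).
  by rewrite qE !mulnDr; lia.
by apply; lia.
Qed.

(** Clears the denominators of [icosahedral ((u + 1) / 3)]; the quadratic term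
    cancels because 1 / 3 is the centre of symmetry of the cubic. *)
Lemma icosahedral27 (a u : nat) : 3 * a = u.+1 ->
  54 * icosahedral a = 5 * u ^ 3 + 3 * u + 8.
Proof.
move=> aE; have := icosahedral_double a.
have a2 : 9 * a ^ 2 = u ^ 2 + 2 * u + 1 by have := congr1 (expn^~ 2) aE; lia.
have a3 : 27 * a ^ 3 = u ^ 3 + 3 * u ^ 2 + 3 * u + 1 by have := congr1 (expn^~ 3) aE; lia.
by lia.
Qed.

(** In units of [P ^ 3], [27 * 8 * icosahedral a] is about [20 * d ^ 3] and the
    multiples of [5 * d * P] reached by [sum_of_eight] span another
    [15 * d ^ 3]. Since [c < 5 * P], [27 * icosahedral c] is at most
    [27 * 5 * 125 / 2 < 8438]; the margin up to 8500 pays for [4 * icosahedral b],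
    for the squares [x ^ 2 + y ^ 2 <= d ^ 2 / 2] and for lower-order terms. The
    residues modulo 3 of [P] and [d] make [a] and [b] integers, and
    [3 * d <= 2 * P] ensures [x, y <= b]. *)
Lemma window_sum (k d n : nat) : let P := 5 ^ k in
  prime d -> P %% 3 = 2 -> d %% 3 = 1 -> 3 * d <= 2 * P ->
  (20 * d ^ 3 + 85 * 100) * P ^ 3 <= 27 * n <= 35 * d ^ 3 * P ^ 3 ->
  icosahedral_sum 13 n.
Proof.
move=> P d_pr Pmod dmod le_dP /andP[lo hi].
have [b bE] : exists b, 3 * b = P.+1 by exists (P.+1 %/ 3); lia.
have [a aE] : exists a, 3 * a = (d * P).+1.
  exists ((d * P).+1 %/ 3); rewrite mulnC divnK // /dvdn -addn1 -modnDml -modnMm.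
  by rewrite dmod Pmod.
have [c lt_c /esym/eqP cE] :=
  icosahedral_mod5X_onto k.+1 (n - 8 * icosahedral a - 4 * icosahedral b).
rewrite expnS -/P in lt_c cE; clearbody P.
have P_gt2 : 2 < P by move: (prime_gt1 d_pr) le_dP; clear; lia.
have fa := icosahedral27 aE; have fb := icosahedral27 bE.
have fc : 2 * icosahedral c <= 625 * P ^ 3.
  apply: leq_trans (icosahedral_le c) _.
  have : c ^ 3 <= (5 * P) ^ 3 by rewrite leq_exp2r // ltnW.
  by rewrite expnMn; clear; lia.
(* The term in [d ^ 2] reserves [5 * P * (x ^ 2 + y ^ 2)], before [x] and [y] are known. *)
have room : 54 * (8 * icosahedral a + 4 * icosahedral b + icosahedral c) +
    135 * P * d ^ 2 <= 54 * n.
  have : P * (3 * d) ^ 2 <= P * (2 * P) ^ 2 by rewrite leq_mul2l leq_exp2r // le_dP orbT.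
  have : 3 * d * P <= 2 * P * P by rewrite leq_mul2r le_dP orbT.
  have : 27 <= P ^ 3 by rewrite (leq_exp2r 3 P (ltn0Sn 2)).
  have : 3 * P ^ 2 <= P ^ 3 by rewrite [P ^ 3]expnS leq_mul2r P_gt2 orbT.
  have : 9 * P <= P ^ 3 by rewrite [P ^ 3]expnSr leq_mul2r (leq_exp2r 3 P (ltn0Sn 1)) P_gt2 orbT.
  move: lo fa fb fc; rewrite !expnMn; clear; lia.
have room' : 8 * icosahedral a + 4 * icosahedral b + icosahedral c <= n.
  by move: room; clear; lia.
move: cE; rewrite eqn_mod_dvd; last by move: room'; clear; lia.
move=> /dvdnP[t tE].
have nE : n = 8 * icosahedral a + 4 * icosahedral b + icosahedral c + 5 * P * t.
  by move: room' tE; clear; lia.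
have [|x [y [q [xle yle tE']]]] := @split_by_prime d t d_pr.
  have : P * d ^ 2 <= P * (2 * t) by move: room nE; clear; lia.
  by rewrite leq_pmul2l // ltnW // ltnW.
have u_gt0 : 0 < d * P by rewrite muln_gt0 prime_gt0 // ltnW // ltnW.
have le_q : q <= a ^ 2.
  have : 9 * q <= (d * P) ^ 2.
    have := leq_mul2l (d * P) (9 * q) ((d * P) ^ 2); rewrite eqn0Ngt u_gt0 /= => <-.
    have : 27 * (8 * icosahedral a + 5 * P * (d * q)) <= 27 * n.
      by rewrite leq_mul2l nE tE'; move: (5 * P); clear; lia.
    by move: hi fa; rewrite -expnS !expnMn; clear; lia.
  by move: (congr1 (expn^~ 2) aE); clear; lia.
have b_gt0 : 0 < b by move: bE; clear; lia.
have le_db : d./2 <= b by move: le_dP bE; clear; lia.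
have xb := leq_trans xle le_db; have yb := leq_trans yle le_db.
have sx := icosahedral_sum_pair b_gt0 xb; have sy := icosahedral_sum_pair b_gt0 yb.
have a_gt0 : 0 < a by move: aE; clear; lia.
have := icosahedral_sumD (icosahedral_sumD (sum_of_eight a_gt0 aE le_q) (icosahedral_sumD sx sy))
  (icosahedral_sum1 c).
rewrite nE tE' bE /=; congr icosahedral_sum.
by rewrite !mulnDr; clear; lia.
Qed.

(** Consecutive windows overlap: [20 * e ^ 3 <= 34.56 * d ^ 3] when
    [e <= 6 / 5 * d], and [0.44 * d ^ 3 >= 8500] as soon as [d >= 27]. *)
Lemma window_ladder (M Q d : nat) (s : seq nat) :
  27 <= d -> path (fun e e' => 5 * e' <= 6 * e) d s -> all (leq 27) s ->
  (20 * d ^ 3 + 85 * 100) * Q <= M <= 35 * (last d s) ^ 3 * Q ->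
  exists2 e, e \in d :: s & (20 * e ^ 3 + 85 * 100) * Q <= M <= 35 * e ^ 3 * Q.
Proof.
elim: s d => [|e s IH] d d_ge /=; first by exists d; rewrite ?mem_head.
move=> /andP[le_ed path_s] /andP[e_ge all_s] /andP[lo hi].
have [le_M|lt_M] := leqP M (35 * d ^ 3 * Q).
  by exists d; rewrite ?mem_head // lo.
have [||||f f_s fP] := IH e => //; last by exists f; rewrite // in_cons f_s orbT.
rewrite hi andbT (leq_trans _ (ltnW lt_M)) // leq_mul2r; apply/orP; right.
have : (5 * e) ^ 3 <= (6 * d) ^ 3 by rewrite leq_exp2r.
have : 27 ^ 3 <= d ^ 3 by rewrite leq_exp2r.
by rewrite !expnMn; lia.
Qed.

(** Together with 97, primes congruent to 1 modulo 3 with successive ratios at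
    most 6 / 5. The chain cannot start earlier, as the preceding such prime is
    79 and 97 / 79 exceeds 6 / 5; it ends where the last window for [P] reaches
    the start of the first window for [25 * P]. *)
Definition ladder : seq nat :=
  [:: 109; 127; 151; 181; 211; 241; 283; 337; 397; 463; 547; 643; 769;
      919; 1093; 1303; 1549; 1831; 2029].

(** The bound lies just above the start of the window of 97 for [P = 5 ^ 5],
    the least odd power of 5 with [3 * 2029 <= 2 * P]. *)
Lemma large_sums (n : nat) : 3 * 10 ^ 16 <= n -> icosahedral_sum 13 n.
Proof.
move=> le_n.
have [K KE] : exists K, K = 20 * 97 ^ 3 + 85 * 100 by eexists.
have [k [k_ge lo hi]] : exists k, [/\ 2 <= k, K * (5 ^ k.*2.+1) ^ 3 <= 27 * n &
   27 * n <= K * (5 ^ k.+1.*2.+1) ^ 3].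
  have [|i le_i|k le_k k_max] := @ex_maxnP (fun k => K * (5 ^ k.*2.+1) ^ 3 <= 27 * n) (27 * n).
  - by exists 2; rewrite KE; lia.
  - apply: leq_trans le_i; apply: (@leq_trans (5 ^ i.*2.+1)).
      by apply: leq_trans (ltnW (ltn_expl _ _)); lia.
    have u_gt0 : 0 < 5 ^ i.*2.+1 by rewrite expn_gt0.
    apply: (@leq_trans ((5 ^ i.*2.+1) ^ 3)); first exact: (@leq_pexp2l _ 1 3 u_gt0).
    by rewrite leq_pmull // KE; clear; lia.
  exists k; split=> //; first by apply: k_max; rewrite KE; lia.
  by rewrite leqNgt; apply/negP => /ltnW/k_max; rewrite ltnn.
have Pmod : 5 ^ k.*2.+1 %% 3 = 2.
  by rewrite expnS -mul2n expnM -modnMmr -modnXm exp1n.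
have P_ge : 3125 <= 5 ^ k.*2.+1.
  by apply: (@leq_pexp2l 5 5) => //; lia.
have hiQ : (5 ^ k.+1.*2.+1) ^ 3 = 5 ^ 6 * (5 ^ k.*2.+1) ^ 3.
  by rewrite (_ : k.+1.*2.+1 = 2 + k.*2.+1) // expnD expnMn -expnM.
have top : K * 5 ^ 6 <= 35 * (last 97 ladder) ^ 3.
  by rewrite KE [last _ _]/=; clear; lia.
have [//|//|//||d d_in dP] := @window_ladder (27 * n) ((5 ^ k.*2.+1) ^ 3) 97 ladder.
  rewrite -KE lo; apply: leq_trans hi _.
  by rewrite hiQ mulnA leq_mul2r top orbT.
have /allP/(_ d d_in)/and3P[d_pr /eqP dmod le_d] :
   all (fun d => [&& prime d, d %% 3 == 1 & 3 * d <= 2 * 3125]) (97 :: ladder) by vm_compute.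
apply: (window_sum d_pr Pmod dmod _ dP); lia.
Qed.

(** * Fifteen summands are necessary *)

Lemma icosahedral_sum_lt124 (s : seq nat) : all (leq 1) s -> \sum_(n <- s) icosahedral n < 124 ->
  exists x y z, size s = x + y + z /\ \sum_(n <- s) icosahedral n = x + 12 * y + 48 * z.
Proof.
elim: s => [|n s IH] /=; first by exists 0, 0, 0; rewrite big_nil.
rewrite big_cons => /andP[n_gt0 s_gt0] lt_sum.
have [//||x [y [z [-> ->]]]] := IH; first by lia.
have : n < 4.
  have := icosahedral_double n; nia.
case: n n_gt0 lt_sum => [|[|[|[|n]]]] // _ _ _.
- by exists x.+1, y, z; rewrite (_ : icosahedral 1 = 1) //; lia.
- by exists x, y.+1, z; rewrite (_ : icosahedral 2 = 12) //; lia.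
- by exists x, y, z.+1; rewrite (_ : icosahedral 3 = 48) //; lia.
Qed.

Theorem theorem1p7 :
  (forall m : nat, 0 < m -> sum_of_at_most_icosahedral 15 m) /\
  (forall k : nat, 0 < k ->
     (forall m : nat, 0 < m -> sum_of_at_most_icosahedral k m) -> 15 <= k).
Proof.
split=> [m _|k _ sum_k].
  apply: icosahedral_sum_positive.
  have [/sums_below_threshold //|/ltnW/large_sums] := leqP m (3 * 10 ^ 16).
  exact: icosahedral_sumW.
have [s [le_sk s_gt0 sE]] := sum_k 95 isT.
have [//||x [y [z [szE]]]] := @icosahedral_sum_lt124 s; first by rewrite -sE.
by rewrite -sE; lia.
Qed.
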